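(* Let $S$ be a finite semigroup, $J$ a regular $\mathscr J$-class of $S$, and $M_J$ the irreducible $\mathbb BS$-module associated to $J$. Then there is a subset $D$ with $\min M_J\subseteq D\subseteq M_J\setminus\{0\}$ such that the generalized character $\psi_{M_J,D}$ is the complex character of $S$ obtained by lifting the right Schützenberger representation of $\mathsf{AGGM}_J(S)$ on an $\mathscr R$-class of its distinguished $\mathscr J$-class via the projection $\Gamma_J\colon S\to\mathsf{AGGM}_J(S)$.
   Context: $\mathbb B=\{0,1\}$ is the boolean semiring ($1+1=1$). A $\mathbb B$-module is a commutative idempotent additive monoid with zero (a join semilattice with minimum $0$). Right $\mathbb BS$-modules are $\mathbb B$-modules with a right action of $S$ by additive maps preserving $0$. Green's relations (with $S^1$ denoting $S$ with an adjoined identity): $s\mathrel{\mathscr J}t$ iff $S^1sS^1=S^1tS^1$; $s\mathrel{\mathscr R}t$ iff $sS^1=tS^1$; $s\mathrel{\mathscr L}t$ iff $S^1s=S^1t$. A $\mathscr J$-class is regular if it contains an idempotent. The module $M_J$: let $B$ be the set of $\mathscr L$-classes of $J$, and let $S$ act on the right of the free $\mathbb B$-module $\mathbb BB$ by: if $b$ is the $\mathscr L$-class of $x\in J$, then $bs$ is the $\mathscr L$-class of $xs$ if $xs\in J$ and $bs=0$ otherwise. Then $M_J=\mathbb BB/{\equiv}$, where $m\equiv n$ iff for all $s\in S$, $ms=0\iff ns=0$. For a finite $\mathbb BS$-module $M$, $\min M$ is the set of strictly join irreducible elements: $m\ne0$ such that $m=m_1+m_2$ implies $m=m_1$ or $m=m_2$.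 For $\min M\subseteq D\subseteq M\setminus\{0\}$, the generalized character is $\psi_{M,D}\colon S\to\mathbb N$, $\psi_{M,D}(s)=|\{m\in D\mid ms=m\}|$. $\mathsf{AGGM}_J(S)$: a semigroup is generalized group mapping if it has a minimal or $0$-minimal ideal (its distinguished ideal) on which it acts faithfully both on the left and on the right; a semigroup is aperiodic if all its maximal subgroups are trivial. There is a unique congruence $\equiv_J$ on $S$ such that $S/{\equiv_J}$ is generalized group mapping with aperiodic distinguished ideal, the image of $J$ being the distinguished $\mathscr J$-class (i.e. the distinguished ideal is the image of $J$, possibly together with $0$), and $J^{\not\uparrow}=\{s\in S\mid J\nsubseteq S^1sS^1\}$ maps to $0$. Put $\mathsf{AGGM}_J(S)=S/{\equiv_J}$, with quotient map $\Gamma_J$; it is isomorphic to the image of $S$ in $\mathrm{End}_{\mathbb B}(M_J)$. Right Schützenberger representation of a semigroup $T$ on an $\mathscr R$-class $R$: $T$ acts on $R$ by partial maps, $r\cdot t=rt$ if $rt\in R$ and undefined otherwise; let $T$ act on $R\cup\{\square\}$ by sending undefined products to $\square$ and setting $\square t=\square$; the associated $\mathbb CT$-module is $\mathbb C(R\cup\{\square\})/\mathbb C\square$, and the complex character is the trace of the action on it. *)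

(* Defs.v *)
From HB Require Import structures.
From mathcomp Require Import all_boot all_algebra mxrepresentation.
From mathcomp Require Import reals complex.

Set Implicit Arguments.
Unset Strict Implicit.
Unset Printing Implicit Defensive.

Import GRing.Theory.
Local Open Scope quotient_scope.
Local Open Scope ring_scope.
Local Open Scope group_scope.

#[short(type="finSemigroupType")]
HB.structure Definition FinSemigroup := {S of Semigroup S & Finite S}.

Section Green.
Variable S : finSemigroupType.
Implicit Types (s t : S) (u v : option S) (J : {set S}).

(* S^1 is modelled by option S, where None is the adjoined identity. *)
Definition lmul1 u s : S := if u is Some a then a * s else s.
Definition rmul1 s v : S := if v is Some a then s * a else s.

Definition left_ideal s : {set S} := [set lmul1 u s | u : option S].
Definition right_ideal s : {set S} := [set rmul1 s v | v : option S].
Definition two_sided_ideal s : {set S} :=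
  [set rmul1 (lmul1 u s) v | u : option S, v : option S].

Definition greenJ s t := two_sided_ideal s == two_sided_ideal t.
Definition greenR s t := right_ideal s == right_ideal t.
Definition greenL s t := left_ideal s == left_ideal t.

Definition Jclass s : {set S} := [set t | greenJ s t].
Definition Rclass s : {set S} := [set t | greenR s t].
Definition Lclass s : {set S} := [set t | greenL s t].

Definition regular J := [exists e in J, e * e == e].

(* J with an upward arrow crossed out *)
Definition not_above J : {set S} := [set s | ~~ (J \subset two_sided_ideal s)].

End Green.

Record jclass (S : finSemigroupType) := JClass {
  jset :> {set S};
  jsetP : jset \in [set Jclass s | s in [set: S]]
}.

(* Finite right modules over the semigroup algebra of S with boolean
   coefficients; a module over the boolean semiring is the same thing as an
   idempotent commutative monoid. *)
HB.mixin Record isBSModule (S : finSemigroupType) M of GRing.Nmodule M := {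
  addmm : forall m : M, (m + m = m)%R;
  sact : M -> S -> M;
  sactM : forall m s t, sact m (s * t) = sact (sact m s) t;
  sactD : forall m n s, (sact (m + n) s = sact m s + sact n s)%R;
  sact0 : forall s, sact 0%R s = 0%R
}.

#[short(type="finBSModType")]
HB.structure Definition FinBSModule (S : finSemigroupType) :=
  {M of isBSModule S M & GRing.Nmodule M & Finite M}.

Section GeneralizedCharacter.
Variables (S : finSemigroupType) (M : finBSModType S).

Definition minM : {set M} :=
  [set m | (m != 0%R) &&
    [forall m1 : M, forall m2 : M,
       (m == m1 + m2)%R ==> ((m == m1) || (m == m2))]].

Definition gen_char (D : {set M}) (s : S) : nat :=
  #|[set m in D | sact m s == m]|.

End GeneralizedCharacter.

Section GreenTheory.
Variable S : finSemigroupType.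
Implicit Types (s t x y : S) (J : jclass S).

Lemma mem_two_sided s : s \in two_sided_ideal s.
Proof. by apply/imset2P; exists None None. Qed.

Lemma two_sided_sub s t :
  s \in two_sided_ideal t -> two_sided_ideal s \subset two_sided_ideal t.
Proof.
case/imset2P=> u v _ _ ->; apply/subsetP=> _ /imset2P[u' v' _ _ ->].
pose uu := match u', u with Some a, Some b => Some (a * b)
           | Some a, None => Some a | None, w => w end.
pose vv := match v, v' with Some a, Some b => Some (a * b)
           | Some a, None => Some a | None, w => w end.
apply/imset2P; exists uu vv => //.
by rewrite /uu /vv {uu vv}; case: u' u v v' => [a|] [b|] [c|] [d|] /=; rewrite ?mulgA.
Qed.

Lemma mulr_two_sided s t : s * t \in two_sided_ideal s.
Proof. by apply/imset2P; exists None (Some t). Qed.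

Lemma greenL_two_sided s t : greenL s t -> greenJ s t.
Proof.
have sub (a b : S) : greenL a b -> two_sided_ideal a \subset two_sided_ideal b.
  move=> /eqP eab; apply: two_sided_sub.
  have : a \in left_ideal b by rewrite -eab; apply/imsetP; exists None.
  by case/imsetP=> u _ ->; apply/imset2P; exists u None.
by move=> L; rewrite /greenJ eqEsubset !sub // /greenL eq_sym.
Qed.

Lemma greenLM s t x : greenL s t -> greenL (s * x) (t * x).
Proof.
have imM (a : S) : left_ideal (a * x) = [set b * x | b in left_ideal a].
  apply/setP=> b; apply/imsetP/imsetP=> [[u _ ->]|[_ /imsetP[u _ ->] ->]].
    exists (lmul1 u a); first by apply/imsetP; exists u.
    by case: u => [c|] //=; rewrite mulgA.
  by exists u => //; case: u => [c|] //=; rewrite mulgA.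
by rewrite /greenL !imM => /eqP->.
Qed.

Lemma jclass_two_sided J x y :
  x \in J -> (y \in J) = (two_sided_ideal y == two_sided_ideal x).
Proof.
by case: J => J /= /imsetP[a _ ->]; rewrite !inE /greenJ => /eqP <-; apply: eq_sym.
Qed.

Lemma jclass_Lclass J x y : x \in J -> y \in Lclass x -> y \in J.
Proof.
move=> xJ; rewrite inE => /greenL_two_sided; rewrite /greenJ => e.
by rewrite (jclass_two_sided y xJ) eq_sym.
Qed.

Lemma jclass_mulr J x s t : x \in J -> x * s * t \in J -> x * s \in J.
Proof.
move=> xJ; rewrite !(jclass_two_sided _ xJ) => /eqP e.
rewrite eqEsubset two_sided_sub ?mulr_two_sided //= -e.
by rewrite two_sided_sub ?mulr_two_sided.
Qed.

Lemma Lclass_id s : s \in Lclass s. Proof. by rewrite inE /greenL. Qed.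

Lemma greenL_sym s t : greenL s t -> greenL t s.
Proof. by rewrite /greenL eq_sym. Qed.

Lemma greenL_trans s t x : greenL s t -> greenL t x -> greenL s x.
Proof. by rewrite /greenL => /eqP->. Qed.

End GreenTheory.

Section FreeModule.
Variables (S : finSemigroupType) (J : jclass S).

Definition lclass_of := {b : {set S} | b \in [set Lclass x | x in (J : {set S})]}.

(* The free module over the booleans on the finite set of L-classes of J: a
   formal sum is encoded as its support, so that addition is union. *)
Definition free_mod := {set lclass_of}.
HB.instance Definition _ := Finite.on free_mod.
HB.instance Definition _ :=
  GRing.isNmodule.Build free_mod (@setUA _) (@setUC _) (@set0U _).

(* As x ranges over b, the L-class of x * s is independent of x, so that this
   is the singleton of that class, or 0 if x * s is not in J. *)
Definition basis_act (b : lclass_of) (s : S) : free_mod :=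
  [set c : lclass_of | [exists x in val b, x * s \in val c]].

Definition free_act (m : free_mod) (s : S) : free_mod :=
  \bigcup_(b in m) basis_act b s.

Lemma free_addmm (m : free_mod) : (m + m = m)%R.
Proof. exact: setUid. Qed.

Lemma lclass_ofP (b : lclass_of) x :
  x \in val b -> (x \in J) /\ val b = Lclass x.
Proof.
case/imsetP: (valP b) => y yJ /= e; rewrite e => xy; split.
  exact: jclass_Lclass xy.
move: xy; rewrite inE => xy; apply/setP=> z; rewrite !inE; apply/idP/idP.
  exact/greenL_trans/greenL_sym.
exact: greenL_trans.
Qed.

Lemma free_actM m s t : free_act m (s * t) = free_act (free_act m s) t.
Proof.
apply/setP=> c; apply/bigcupP/bigcupP.
  case=> b bm; rewrite inE => /existsP[x /andP[xb xst]].
  have [xJ _] := lclass_ofP xb; have [xstJ _] := lclass_ofP xst.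
  rewrite mulgA in xst xstJ.
  have xsJ := jclass_mulr xJ xstJ.
  have Lxs : Lclass (x * s) \in [set Lclass x | x in (J : {set S})].
    by apply/imsetP; exists (x * s).
  exists (Sub (Lclass (x * s)) Lxs : lclass_of).
    apply/bigcupP; exists b => //; rewrite inE; apply/existsP; exists x.
    by rewrite xb SubK Lclass_id.
  by rewrite inE; apply/existsP; exists (x * s); rewrite SubK Lclass_id.
case=> d /bigcupP[b bm]; rewrite !inE => /existsP[x /andP[xb xsd]].
case/existsP=> y /andP[yd ytc]; exists b => //; rewrite inE.
apply/existsP; exists x; rewrite xb mulgA.
have [_ ed] := lclass_ofP xsd; rewrite {}ed inE in yd.
have [_ ->] := lclass_ofP ytc.
by rewrite inE; apply/greenLM/greenL_sym.
Qed.

Lemma free_actD m n s :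
  (free_act (m + n)%R s = free_act m s + free_act n s)%R.
Proof. exact: bigcup_setU. Qed.

Lemma free_act0 s : free_act 0%R s = 0%R.
Proof. exact: big_set0. Qed.

HB.instance Definition _ :=
  isBSModule.Build S free_mod free_addmm free_actM free_actD free_act0.

End FreeModule.

Section MJ.
Variables (S : finSemigroupType) (J : jclass S).

Definition ann_eq (m n : free_mod J) :=
  [forall s : S, (sact m s == 0%R) == (sact n s == 0%R)].

Lemma ann_eq_refl : reflexive ann_eq.
Proof. by move=> m; apply/forallP. Qed.

Lemma ann_eq_sym : symmetric ann_eq.
Proof. by move=> m n; apply: eq_forallb => s; rewrite eq_sym. Qed.

Lemma ann_eq_trans : transitive ann_eq.
Proof.
move=> n m p /forallP mn /forallP np; apply/forallP=> s.
by rewrite (eqP (mn s)).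
Qed.

Canonical ann_equiv := EquivRel ann_eq ann_eq_refl ann_eq_sym ann_eq_trans.

Definition MJ := {eq_quot ann_equiv}.
HB.instance Definition _ := Choice.on MJ.
HB.instance Definition _ := EqQuotient.on MJ.
HB.instance Definition _ := Finite.copy MJ (can_type EquivQuot.ereprK).

Lemma free_add_eq0 (m n : free_mod J) :
  (m + n == 0)%R = (m == 0%R) && (n == 0%R).
Proof. exact: setU_eq0. Qed.

Lemma ann_eqD (m m' n n' : free_mod J) :
  ann_eq m m' -> ann_eq n n' -> ann_eq (m + n)%R (m' + n')%R.
Proof.
move=> /forallP mm /forallP nn; apply/forallP=> s.
by rewrite !sactD !free_add_eq0 (eqP (mm s)) (eqP (nn s)).
Qed.

Lemma ann_eq_act (m n : free_mod J) s :
  ann_eq m n -> ann_eq (sact m s) (sact n s).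
Proof. by move=> /forallP mn; apply/forallP=> t; rewrite -!sactM. Qed.

Definition MJ_zero : MJ := \pi_MJ 0%R.
Definition MJ_add (a b : MJ) : MJ := \pi_MJ (repr a + repr b)%R.
Definition MJ_act (a : MJ) (s : S) : MJ := \pi_MJ (sact (repr a) s).

Lemma MJ_piD (m n : free_mod J) :
  MJ_add (\pi_MJ m) (\pi_MJ n) = \pi_MJ (m + n)%R.
Proof. by apply/eqmodP/ann_eqD; apply/eqmodP; rewrite reprK. Qed.

Lemma MJ_pi_act (m : free_mod J) s : MJ_act (\pi_MJ m) s = \pi_MJ (sact m s).
Proof. by apply/eqmodP/ann_eq_act/eqmodP; rewrite reprK. Qed.

Lemma MJ_addA : associative MJ_add.
Proof.
move=> a b c; rewrite -[a]reprK -[b]reprK -[c]reprK.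
by rewrite (MJ_piD (repr a) (repr b)) (MJ_piD (repr b) (repr c)) !MJ_piD addrA.
Qed.

Lemma MJ_addC : commutative MJ_add.
Proof. by move=> a b; rewrite -[a]reprK -[b]reprK !MJ_piD addrC. Qed.

Lemma MJ_add0 : left_id MJ_zero MJ_add.
Proof. by move=> a; rewrite -[a]reprK MJ_piD add0r. Qed.

HB.instance Definition _ := GRing.isNmodule.Build MJ MJ_addA MJ_addC MJ_add0.

Lemma MJ_addmm (a : MJ) : (a + a = a)%R.
Proof. by rewrite -[a]reprK [LHS]MJ_piD addmm. Qed.

Lemma MJ_actM a s t : MJ_act a (s * t) = MJ_act (MJ_act a s) t.
Proof. by rewrite -[a]reprK (MJ_pi_act _ s) !MJ_pi_act sactM. Qed.

Lemma MJ_actD a b s : (MJ_act (a + b)%R s = MJ_act a s + MJ_act b s)%R.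
Proof.
rewrite -[a]reprK -[b]reprK.
by rewrite [X in MJ_act X s]MJ_piD !MJ_pi_act sactD [RHS]MJ_piD.
Qed.

Lemma MJ_act0 s : MJ_act 0%R s = 0%R.
Proof. by rewrite [LHS]MJ_pi_act sact0. Qed.

HB.instance Definition _ :=
  isBSModule.Build S MJ MJ_addmm MJ_actM MJ_actD MJ_act0.

End MJ.

Record congruence (S : semigroupType) := Congruence {
  congr_rel :> equiv_rel S;
  congrM : forall a b c d,
    congr_rel a b -> congr_rel c d -> congr_rel (a * c) (b * d)
}.

Section QuotientSemigroup.
Variables (S : finSemigroupType) (E : congruence S).

Definition quo := {eq_quot (E : equiv_rel S)}.
HB.instance Definition _ := Choice.on quo.
HB.instance Definition _ := EqQuotient.on quo.
HB.instance Definition _ := Finite.copy quo (can_type EquivQuot.ereprK).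

Definition quo_mul (a b : quo) : quo := \pi_quo (repr a * repr b).

Lemma quo_piM (s t : S) : quo_mul (\pi_quo s) (\pi_quo t) = \pi_quo (s * t).
Proof. by apply/eqmodP/congrM; apply/eqmodP; rewrite reprK. Qed.

Lemma quo_mulA : associative quo_mul.
Proof.
move=> a b c; rewrite -[a]reprK -[b]reprK -[c]reprK.
by rewrite (quo_piM (repr a) (repr b)) (quo_piM (repr b)) !quo_piM mulgA.
Qed.

HB.instance Definition _ := isSemigroup.Build quo quo_mulA.

Definition quo_map (s : S) : quo := \pi_quo s.

End QuotientSemigroup.

Section GeneralizedGroupMapping.
Variable T : finSemigroupType.
Implicit Types (z : T) (I G : {set T}).

Definition is_zero z := forall t : T, z * t = z /\ t * z = z.

Definition is_ideal I :=
  I != set0 /\ forall i t, i \in I -> (i * t \in I) /\ (t * i \in I).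

Definition minimal_ideal I :=
  is_ideal I /\ forall K : {set T}, is_ideal K -> K \subset I -> K = I.

Definition zero_minimal_ideal z I :=
  [/\ is_zero z, is_ideal I, I <> [set z] &
      forall K : {set T}, is_ideal K -> K \subset I -> K = [set z] \/ K = I].

(* I is minimal or 0-minimal, and JI is its nonzero part, respectively. *)
Definition distinguished I JI :=
  (minimal_ideal I /\ JI = I) \/
  (exists z, zero_minimal_ideal z I /\ JI = I :\ z).

Definition acts_faithfully_right I :=
  forall s t, (forall i, i \in I -> i * s = i * t) -> s = t.

Definition acts_faithfully_left I :=
  forall s t, (forall i, i \in I -> s * i = t * i) -> s = t.

(* T is generalized group mapping with distinguished ideal I and distinguished
   J-class JI. *)
Definition generalized_group_mapping I JI :=
  [/\ distinguished I JI, acts_faithfully_right I & acts_faithfully_left I].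

Definition is_subgroup G : bool :=
  [forall a in G, forall b in G, a * b \in G] &&
  [exists e in G, forall a in G,
     [&& e * a == a, a * e == a &
         [exists b in G, (a * b == e) && (b * a == e)]]].

Definition aperiodic I :=
  forall G, maxset (fun H : {set T} => (H \subset I) && is_subgroup H) G ->
    #|G| = 1%N.

End GeneralizedGroupMapping.

(* The elements of not_above J are sent to the zero of the quotient, which is
   required to lie outside the image of J: otherwise the universal congruence
   (with one-element quotient) would always qualify. *)
Definition AGGM_congruence (S : finSemigroupType) (J : jclass S)
    (E : congruence S) :=
  (exists I : {set quo E},
     generalized_group_mapping I [set quo_map E s | s in (J : {set S})] /\
     aperiodic I) /\
  (forall s, s \in not_above J ->
     is_zero (quo_map E s) /\
     quo_map E s \notin [set quo_map E x | x in (J : {set S})]).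

Section Schutzenberger.
Variables (F : fieldType) (T : finSemigroupType) (R : {set T}).

(* R with an adjoined sink (the box), represented by None *)
Definition sink_ext := option {r : T | r \in R}.

Definition sch_act (o : sink_ext) (t : T) : sink_ext :=
  if o is Some r then insub (val r * t) else None.

(* The action of t on row vectors over F with basis sink_ext, and the line
   spanned by the sink, as the row space of a matrix. *)
Definition sch_full_mx (t : T) : 'M[F]_#|{: sink_ext}| :=
  \matrix_(i, j) (sch_act (enum_val i) t == enum_val j)%:R.

Definition sink_mx : 'M[F]_#|{: sink_ext}| :=
  delta_mx (enum_rank None) (enum_rank None).

(* The induced action on the quotient by that line, as in factmod_mx of
   mxrepresentation (which is restricted to representations of groups). *)
Definition sch_mx (t : T) : 'M[F]_(\rank (cokermx sink_mx)) :=
  in_factmod sink_mx (val_factmod 1%:M *m sch_full_mx t)%R.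

Definition sch_char (t : T) : F := (\tr (sch_mx t))%R.

End Schutzenberger.

(* Main.v *)
Require Import Defs.
From mathcomp Require Import all_boot all_algebra reals complex.
From mathcomp Require Import mxrepresentation.

Set Implicit Arguments.
Unset Strict Implicit.
Unset Printing Implicit Defensive.

Import GRing.Theory.
Local Open Scope quotient_scope.
Local Open Scope group_scope.

(** The set [D] is the image in [MJ J] of the set of L-classes of [J].  It
    avoids [0] because regularity gives each [y] in [J] an idempotent [f] with
    [y * f = y], and it contains [minM] because it spans [MJ J] additively.

    The trace of the Schutzenberger representation counts the fixed points of
    a partial map ([sch_char_card]), so two fixed-point counts are to be
    compared.  Write [pi] for [quo_map E] and [q y] for the class of the
    L-class of [y] in [MJ J], and fix [x = pi x0] with [x0] in [J].  Every
    element of the R-class of [x] is [pi y] for some [y] in [J], and every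
    element of [D] is [q y] for some [y] in [J] with [pi y] in the R-class of
    [x], because the R-class of [x0] meets every L-class of [J].  The heart of
    the matter is that, for [y] and [y'] in [J] with R-equivalent images,
    [pi y = pi y'] if and only if [q y = q y'].  By construction [q y = q y']
    says that [y * s] and [y' * s] are in [J] for the same [s].

    - If [pi y = pi y'], this holds because [pi] separates [J] from
      [not_above J] ([mem_quo_mulr]).
    - Conversely ([quo_eq_of_annihilator]), let [i] be in the distinguished
      ideal.  Either [pi y * i] and [pi y' * i] are both zero, or, by stability
      of finite semigroups, both are L-equivalent to [i] while being
      R-equivalent to each other; aperiodicity then makes them equal
      ([aperiodic_H_trivial]).  Left faithfulness yields [pi y = pi y'].

    Hence [pi y |-> q y] is a bijection from the R-class of [x] onto [D].  It
    matches fixed points of [s]: when [y * s] stays in [J] it is R-equivalent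
    to [y] by stability, so the same equivalence applies to [y] and [y * s]. *)

(** * Green's relations in a finite semigroup *)

(** The product of the monoid obtained by adjoining an identity to [S]. *)
Definition mul1 (S : finSemigroupType) (u v : option S) : option S :=
  if u is Some a then Some (rmul1 a v) else v.

Lemma rmul1A (S : finSemigroupType) (s : S) u v :
  rmul1 (rmul1 s u) v = rmul1 s (mul1 u v).
Proof. by case: u v => [a|] [b|] //=; rewrite mulgA. Qed.

Lemma lmul1A (S : finSemigroupType) (s : S) u v :
  lmul1 u (lmul1 v s) = lmul1 (mul1 u v) s.
Proof. by case: u v => [a|] [b|] //=; rewrite mulgA. Qed.

Lemma lmul1_rmul1 (S : finSemigroupType) (s : S) u v :
  lmul1 u (rmul1 s v) = rmul1 (lmul1 u s) v.
Proof. by case: u v => [a|] [b|] //=; rewrite mulgA. Qed.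

Lemma lmul1M (S : finSemigroupType) (s t : S) u :
  lmul1 u (s * t) = lmul1 u s * t.
Proof. exact: lmul1_rmul1 s u (Some t). Qed.

Lemma mulM_rmul1 (S : finSemigroupType) (s t : S) v :
  s * rmul1 t v = rmul1 (s * t) v.
Proof. exact: lmul1_rmul1 t (Some s) v. Qed.

Lemma mem_right_ideal (S : finSemigroupType) (s : S) v :
  rmul1 s v \in right_ideal s.
Proof. by apply/imsetP; exists v. Qed.

Lemma mem_left_ideal (S : finSemigroupType) (s : S) u :
  lmul1 u s \in left_ideal s.
Proof. by apply/imsetP; exists u. Qed.

Lemma greenRP (S : finSemigroupType) (s t : S) :
  reflect ((exists u, s = rmul1 t u) /\ exists v, t = rmul1 s v) (greenR s t).
Proof.
apply: (iffP eqP) => [e | [[u es] [v et]]].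
  have /imsetP[u _ es] : s \in right_ideal t.
    by rewrite -e; apply/imsetP; exists None.
  have /imsetP[v _ et] : t \in right_ideal s.
    by rewrite e; apply/imsetP; exists None.
  by split; [exists u | exists v].
apply/eqP; rewrite eqEsubset; apply/andP.
split; apply/subsetP=> _ /imsetP[w _ ->].
  by rewrite es rmul1A mem_right_ideal.
by rewrite et rmul1A mem_right_ideal.
Qed.

Lemma greenLP (S : finSemigroupType) (s t : S) :
  reflect ((exists u, s = lmul1 u t) /\ exists v, t = lmul1 v s) (greenL s t).
Proof.
apply: (iffP eqP) => [e | [[u es] [v et]]].
  have /imsetP[u _ es] : s \in left_ideal t.
    by rewrite -e; apply/imsetP; exists None.
  have /imsetP[v _ et] : t \in left_ideal s.
    by rewrite e; apply/imsetP; exists None.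
  by split; [exists u | exists v].
apply/eqP; rewrite eqEsubset; apply/andP.
split; apply/subsetP=> _ /imsetP[w _ ->].
  by rewrite es lmul1A mem_left_ideal.
by rewrite et lmul1A mem_left_ideal.
Qed.

Lemma greenR_sym (S : finSemigroupType) (s t : S) : greenR s t -> greenR t s.
Proof. by rewrite /greenR eq_sym. Qed.

Lemma greenR_trans (S : finSemigroupType) (s t x : S) :
  greenR s t -> greenR t x -> greenR s x.
Proof. by rewrite /greenR => /eqP->. Qed.

Lemma greenJ_factor (S : finSemigroupType) (s t : S) :
  greenJ s t -> exists u v, s = rmul1 (lmul1 u t) v.
Proof.
move=> /eqP e; have : s \in two_sided_ideal t by rewrite -e mem_two_sided.
by case/imset2P=> u v _ _ ->; exists u, v.
Qed.

(** Multiplying by an element cannot enlarge a principal right ideal.  If [s]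
    and [rmul1 s v] are J-equivalent, then some left multiplication maps the
    right ideal of the latter onto a set that contains the right ideal of [s],
    so the two nested ideals have the same cardinality. *)
Lemma stableR (S : finSemigroupType) (s : S) v :
  greenJ s (rmul1 s v) -> greenR s (rmul1 s v).
Proof.
move=> /greenJ_factor[a [b es]].
have sub : right_ideal (rmul1 s v) \subset right_ideal s.
  by apply/subsetP=> _ /imsetP[w _ ->]; rewrite rmul1A mem_right_ideal.
rewrite /greenR eq_sym eqEcard sub /=.
apply: (@leq_trans #|lmul1 a @: right_ideal (rmul1 s v)|);
  last exact: leq_imset_card.
apply/subset_leq_card/subsetP=> _ /imsetP[w _ ->].
by rewrite {1}es rmul1A -lmul1_rmul1; exact/imset_f/mem_right_ideal.
Qed.

Lemma stableL (S : finSemigroupType) (s : S) u :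
  greenJ s (lmul1 u s) -> greenL s (lmul1 u s).
Proof.
move=> /greenJ_factor[a [b es]].
have sub : left_ideal (lmul1 u s) \subset left_ideal s.
  by apply/subsetP=> _ /imsetP[w _ ->]; rewrite lmul1A mem_left_ideal.
rewrite /greenL eq_sym eqEcard sub /=.
apply: (@leq_trans #|(fun z => rmul1 z b) @: left_ideal (lmul1 u s)|);
  last exact: leq_imset_card.
apply/subset_leq_card/subsetP=> _ /imsetP[w _ ->].
rewrite {1}es lmul1_rmul1 lmul1A.
by apply/imsetP; exists (lmul1 (mul1 w a) (lmul1 u s)); rewrite ?mem_left_ideal.
Qed.

Lemma jclass_greenJ (S : finSemigroupType) (J : jclass S) x y :
  x \in J -> (y \in J) = greenJ x y.
Proof. by move=> xJ; rewrite (jclass_two_sided _ xJ) eq_sym. Qed.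

Lemma jclass_stableR (S : finSemigroupType) (J : jclass S) x s :
  x \in J -> x * s \in J -> greenR (x * s) x.
Proof.
by move=> xJ; rewrite (jclass_greenJ _ xJ) => /(@stableR _ x (Some s))/greenR_sym.
Qed.

Lemma jclass_stableL (S : finSemigroupType) (J : jclass S) x s :
  x \in J -> s * x \in J -> greenL (s * x) x.
Proof.
by move=> xJ; rewrite (jclass_greenJ _ xJ) => /(@stableL _ x (Some s))/greenL_sym.
Qed.

(** In a finite semigroup the relations J and D coincide: writing
    [y = u * x * v], the element [x * v] works by stability on both sides. *)
Lemma jclass_DP (S : finSemigroupType) (J : jclass S) x y :
  x \in J -> y \in J -> exists w, [/\ w \in J, greenR w x & greenL w y].
Proof.
move=> xJ yJ; have Jyx : greenJ y x by rewrite -(jclass_greenJ _ yJ).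
have [u [v ey]] := greenJ_factor Jyx.
have wJ : rmul1 x v \in J.
  rewrite (jclass_two_sided _ xJ) eqEsubset; apply/andP; split.
    by apply: two_sided_sub; apply/imset2P; exists None v.
  move: Jyx; rewrite /greenJ => /eqP <-; apply: two_sided_sub.
  by apply/imset2P; exists u None; rewrite //= ey lmul1_rmul1.
have ey' : y = lmul1 u (rmul1 x v) by rewrite lmul1_rmul1.
exists (rmul1 x v); split=> //.
  by apply/greenR_sym/stableR; rewrite -(jclass_greenJ _ xJ).
by rewrite ey'; apply: stableL; rewrite -(jclass_greenJ _ wJ) -ey'.
Qed.

(** An idempotent [e] of [J] is R-equivalent to some [w] in the L-class of [y];
    if [e = w * v'], then [v' * w] is idempotent and L-equivalent to [w]. *)
Lemma regular_Lidem (S : finSemigroupType) (J : jclass S) y :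
  regular J -> y \in J -> exists f, [/\ f \in J, f * f = f & greenL f y].
Proof.
case/exists_inP=> e eJ /eqP ee yJ.
have [w [wJ /greenRP[[v ew] [v' ew']] wy]] := jclass_DP eJ yJ.
have e_w : e * w = w by rewrite ew mulM_rmul1 ee.
exists (lmul1 v' w).
have Lfw : greenL (lmul1 v' w) w.
  apply/greenLP; split; first by exists v'.
  exists (Some w); case: v' ew' => [a|] /= ew'; last by rewrite -ew' ee.
  by rewrite mulgA -ew' e_w.
have fJ : lmul1 v' w \in J.
  by apply: (jclass_Lclass wJ); rewrite inE; apply: greenL_sym.
split=> //; last exact: greenL_trans Lfw wy.
case: v' ew' {Lfw fJ} => [a|] /= ew'; last by rewrite -ew' ee.
by rewrite -mulgA (mulgA w) -ew' e_w.
Qed.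

(** * Aperiodic ideals *)

Lemma aperiodic_subgroup (T : finSemigroupType) (I G : {set T}) :
  aperiodic I -> G \subset I -> is_subgroup G -> (#|G| <= 1)%N.
Proof.
move=> apI GI sG.
have [|H mH GH] :=
  @maxset_exists _ (fun H : {set T} => (H \subset I) && is_subgroup H) G.
  by rewrite GI.
by rewrite -(apI H mH) subset_leq_card.
Qed.

Lemma mem_ideal_rmul1 (T : finSemigroupType) (I : {set T}) i v :
  is_ideal I -> i \in I -> rmul1 i v \in I.
Proof. by case=> _ idI iI; case: v => [a|] //=; case: (idI i a iI). Qed.

(** The invertible elements of the local monoid at [e] form a subgroup, which
    lies in the ideal of [e]. *)
Lemma aperiodic_units (T : finSemigroupType) (I : {set T}) (e g h : T) :
    is_ideal I -> aperiodic I -> e \in I -> e * e = e ->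
    e * g = g -> g * e = g -> e * h = h -> h * e = h ->
    g * h = e -> h * g = e ->
  g = e.
Proof.
move=> [_ idI] apI eI ee eg ge eh he gh hg.
pose G := [set a : T | [&& e * a == a, a * e == a &
   [exists b, [&& e * b == b, b * e == b, a * b == e & b * a == e]]]].
have GI : G \subset I.
  by apply/subsetP=> a; rewrite inE => /and3P[/eqP <- _ _]; case: (idI e a eI).
have eG : e \in G.
  by rewrite inE ee eqxx; apply/existsP; exists e; rewrite ee eqxx.
have gG : g \in G.
  rewrite inE eg ge !eqxx; apply/existsP; exists h.
  by rewrite eh he gh hg !eqxx.
have sG : is_subgroup G.
  apply/andP; split.
    apply/forall_inP=> a; rewrite inE => /and3P[/eqP ea /eqP ae /existsP[a']].
    case/and4P=> /eqP ea' /eqP a'e /eqP aa' /eqP a'a.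
    apply/forall_inP=> b; rewrite inE => /and3P[/eqP eb /eqP be /existsP[b']].
    case/and4P=> /eqP eb' /eqP b'e /eqP bb' /eqP b'b.
    rewrite inE mulgA ea -mulgA be !eqxx /=; apply/existsP; exists (b' * a').
    rewrite mulgA eb' -mulgA a'e !eqxx /=; apply/andP; split; apply/eqP.
      by rewrite -mulgA (mulgA b) bb' ea'.
    by rewrite -mulgA (mulgA a') a'a eb.
  apply/exists_inP; exists e => //; apply/forall_inP=> a.
  rewrite inE => /and3P[ea ae /existsP[b /and4P[eb be ab ba]]].
  rewrite ea ae; apply/exists_inP; exists b; last by rewrite ab ba.
  by rewrite inE eb be; apply/existsP; exists a; rewrite ea ae ba ab.
have /card_le1P/(_ _ gG e) := aperiodic_subgroup apI GI sG.
by rewrite eG inE => /esym/eqP.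
Qed.

(** If [v = u * w'] and [u = v * w], then right multiplication by
    [e * w' * e] and by [e * w * e] exchanges [u] and [v].  As [e] is a left
    multiple of both [u] and [v], the two multipliers are inverse to each other
    in the local monoid at [e], where aperiodicity leaves no unit but [e]. *)
Lemma aperiodic_H_trivial (T : finSemigroupType) (I : {set T}) (e u v : T) :
    is_ideal I -> aperiodic I -> e \in I -> e * e = e ->
    greenL e u -> greenL e v -> greenR u v ->
  u = v.
Proof.
move=> idI apI eI ee /greenLP[[z ez] [z' uz]] /greenLP[[y ey] [y' vy]].
have ue : u * e = u by rewrite uz -lmul1M ee.
have ve : v * e = v by rewrite vy -lmul1M ee.
move=> /greenRP[[w uw] [w' vw]].
have key (a b : T) p : a = rmul1 b p -> a * e = a -> b * e = b ->
    b * (e * rmul1 e p * e) = a.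
  by move=> -> ae be; rewrite !mulgA be mulM_rmul1 be ae.
have eu x : e = lmul1 z u -> u * x = u -> e * x = e
  by move=> -> ux; rewrite -lmul1M ux.
have ev x : e = lmul1 y v -> v * x = v -> e * x = e
  by move=> -> vx; rewrite -lmul1M vx.
set g := e * rmul1 e w' * e; set h := e * rmul1 e w * e.
have ug : u * g = v by apply: key.
have vh : v * h = u by apply: key.
have eg : e * g = g by rewrite /g !mulgA ee.
have eh : e * h = h by rewrite /h !mulgA ee.
have ge : g * e = g by rewrite /g -!mulgA ee.
have he : h * e = h by rewrite /h -!mulgA ee.
rewrite -ug (@aperiodic_units _ I e g h) //.
  by rewrite -eg -mulgA (eu (g * h)) // mulgA ug vh.
by rewrite -eh -mulgA (ev (h * g)) // mulgA vh ug.
Qed.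

(** * The distinguished ideal *)

Lemma distinguished_ideal (T : finSemigroupType) (I JI : {set T}) :
  distinguished I JI -> is_ideal I.
Proof. by case=> [[[idI _] _]|[z [[_ idI _ _] _]]]. Qed.

Lemma distinguished_sub (T : finSemigroupType) (I JI : {set T}) :
  distinguished I JI -> JI \subset I.
Proof. by case=> [[_ ->]|[z [_ ->]]]; rewrite ?subD1set. Qed.

Lemma distinguished_or_zero (T : finSemigroupType) (I JI : {set T}) i :
  distinguished I JI -> i \in I -> i \in JI \/ is_zero i.
Proof.
case=> [[_ ->]|[z [[zz _ _ _] ->]]] iI; first by left.
by have [->|iz] := eqVneq i z; [right | left; rewrite !inE iz].
Qed.

(** No nonzero element is R-equivalent to zero, so the nonzero part of the
    ideal is a union of R-classes. *)
Lemma distinguished_greenR (T : finSemigroupType) (I JI : {set T}) x r :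
  distinguished I JI -> x \in JI -> greenR r x -> r \in JI.
Proof.
move=> dI xJI /greenRP[[v rx] [w xr]].
have rI : r \in I.
  rewrite rx; apply: mem_ideal_rmul1 (distinguished_ideal dI) _.
  exact: subsetP (distinguished_sub dI) x xJI.
case: dI xJI => [[_ ->] //|[z [[zz _ _ _] ->]]];
  rewrite !inE rI andbT => /andP[xz _].
apply: contraNneq xz => rz; rewrite xr rz; case: w {xr} => [a|] //=.
by case: (zz a) => ->.
Qed.

Lemma is_zero_uniq (T : finSemigroupType) (a b : T) :
  is_zero a -> is_zero b -> a = b.
Proof. by move=> za zb; case: (za b) => <- _; case: (zb a) => _ ->. Qed.

(** * The generalized group mapping quotient *)

Lemma quo_mapM (S : finSemigroupType) (E : congruence S) s t :
  quo_map E (s * t) = quo_map E s * quo_map E t.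
Proof. exact/esym/quo_piM. Qed.

Lemma greenR_quo (S : finSemigroupType) (E : congruence S) (s t : S) :
  greenR s t -> greenR (quo_map E s) (quo_map E t).
Proof.
case/greenRP=> [[u es] [v et]]; apply/greenRP; split.
  by exists (omap (quo_map E) u); rewrite {1}es;
    case: (u) => [a|] //=; rewrite quo_mapM.
by exists (omap (quo_map E) v); rewrite {1}et;
    case: (v) => [a|] //=; rewrite quo_mapM.
Qed.

Lemma greenL_quo (S : finSemigroupType) (E : congruence S) (s t : S) :
  greenL s t -> greenL (quo_map E s) (quo_map E t).
Proof.
case/greenLP=> [[u es] [v et]]; apply/greenLP; split.
  by exists (omap (quo_map E) u); rewrite {1}es;
    case: (u) => [a|] //=; rewrite quo_mapM.
by exists (omap (quo_map E) v); rewrite {1}et;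
    case: (v) => [a|] //=; rewrite quo_mapM.
Qed.

Lemma not_above_mulr (S : finSemigroupType) (J : jclass S) x s :
  x \in J -> x * s \notin J -> x * s \in not_above J.
Proof.
move=> xJ; apply: contraNT; rewrite inE negbK => /subsetP/(_ x xJ) xs.
rewrite (jclass_two_sided _ xJ) eqEsubset !two_sided_sub //.
exact: mulr_two_sided.
Qed.

(** A product [x * s] that leaves [J] falls strictly below it, hence into
    [not_above J], whose image is disjoint from that of [J]. *)
Lemma mem_quo_mulr (S : finSemigroupType) (J : jclass S) (E : congruence S)
    x s :
  AGGM_congruence J E -> x \in J ->
  (quo_map E (x * s) \in [set quo_map E y | y in (J : {set S})]) = (x * s \in J).
Proof.
move=> [_ zE] xJ; have [xsJ|/(not_above_mulr xJ)/zE[_ /negbTE //]] :=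
  boolP (_ * _ \in J).
exact: imset_f.
Qed.

(** Left faithfulness reduces the claim to equality of the products with each
    element of the distinguished ideal.  The hypothesis on [s] makes the two
    products nonzero simultaneously, and nonzero ones are both L- and
    R-equivalent. *)
Lemma quo_eq_of_annihilator (S : finSemigroupType) (J : jclass S) (E : congruence S)
    y y' :
    regular J -> AGGM_congruence J E -> y \in J -> y' \in J ->
    greenR (quo_map E y) (quo_map E y') ->
    (forall s, (y * s \in J) = (y' * s \in J)) ->
  quo_map E y = quo_map E y'.
Proof.
move=> regJ [[I [[dI _ faithL] apI]] zE] yJ y'J Ryy' annE.
have idI := distinguished_ideal dI.
apply: faithL => i iI; have [/imsetP[z zJ ->]|zi] :=
  distinguished_or_zero dI iI; last first.
  by case: (zi (quo_map E y)) => _ ->; case: (zi (quo_map E y')) => _ ->.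
rewrite -!quo_mapM; have [yzJ|yzJ] := boolP (y * z \in J); last first.
  have y'zJ : y' * z \notin J by rewrite -annE.
  apply: is_zero_uniq; first by case: (zE _ (not_above_mulr yJ yzJ)).
  by case: (zE _ (not_above_mulr y'J y'zJ)).
have y'zJ : y' * z \in J by rewrite -annE.
have [f [fJ ff Lfz]] := regular_Lidem regJ zJ.
have Lf t : t * z \in J -> greenL (quo_map E f) (quo_map E (t * z)).
  by move=> tzJ; apply/greenL_quo/(greenL_trans Lfz);
    apply/greenL_sym/(jclass_stableL zJ).
apply: (aperiodic_H_trivial idI apI _ _ (Lf y yzJ) (Lf y' y'zJ)).
- exact/(subsetP (distinguished_sub dI))/imset_f.
- by rewrite -quo_mapM ff.
apply: greenR_trans (greenR_quo E (jclass_stableR yJ yzJ)) _.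
apply: greenR_trans Ryy' _.
exact: greenR_sym (greenR_quo E (jclass_stableR y'J y'zJ)).
Qed.

(** * The image of the L-classes in the irreducible module *)

(** The basis vector of the L-class of [y] when [y] is in [J]; it vanishes
    otherwise, so that [basis J (y * s)] is the image under [s] of the vector
    of [y] even when [y * s] leaves [J]. *)
Definition basis (S : finSemigroupType) (J : jclass S) (y : S) : free_mod J :=
  [set b : lclass_of J | y \in val b].

Definition MJ_class (S : finSemigroupType) (J : jclass S) (y : S) : MJ J :=
  \pi_(MJ J) (basis J y).

Lemma basis_set1 (S : finSemigroupType) (J : jclass S) (b : lclass_of J) y :
  y \in val b -> basis J y = [set b].
Proof.
move=> yb; apply/setP=> c; rewrite !inE; apply/idP/eqP => [yc|-> //].
by apply: val_inj; case: (lclass_ofP yb) => _ ->; case: (lclass_ofP yc) => _ ->.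
Qed.

Lemma basis_eq0 (S : finSemigroupType) (J : jclass S) y :
  (basis J y == 0%R) = (y \notin J).
Proof.
apply/eqP/idP => [b0|yJ].
  apply/negP=> yJ.
  have Ly : Lclass y \in [set Lclass x | x in (J : {set S})] by apply: imset_f.
  have : Sub (Lclass y) Ly \in basis J y by rewrite inE SubK Lclass_id.
  by rewrite b0 inE.
by apply/setP=> b; rewrite !inE; apply: contraNF yJ => /lclass_ofP[].
Qed.

Lemma basis_sact (S : finSemigroupType) (J : jclass S) y s :
  y \in J -> sact (basis J y) s = basis J (y * s).
Proof.
move=> yJ; apply/setP=> c; rewrite [RHS]inE; apply/bigcupP/idP.
  case=> b; rewrite !inE => yb /existsP[x /andP[xb xsc]].
  have [_ eb] := lclass_ofP yb; rewrite eb inE in xb.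
  by have [_ ->] := lclass_ofP xsc; rewrite inE; apply/greenLM/greenL_sym.
have Ly : Lclass y \in [set Lclass x | x in (J : {set S})] by apply: imset_f.
move=> ysc; exists (Sub (Lclass y) Ly); first by rewrite inE SubK Lclass_id.
by rewrite inE; apply/existsP; exists y; rewrite SubK Lclass_id.
Qed.

Lemma MJ_class_sact (S : finSemigroupType) (J : jclass S) y s :
  y \in J -> sact (MJ_class J y) s = MJ_class J (y * s).
Proof. by move=> yJ; rewrite [LHS]MJ_pi_act [X in \pi_(_) X]basis_sact. Qed.

Lemma MJ_class_eqP (S : finSemigroupType) (J : jclass S) y y' :
  y \in J -> y' \in J ->
  (MJ_class J y = MJ_class J y') <-> (forall s, (y * s \in J) = (y' * s \in J)).
Proof.
move=> yJ y'J; split=> [/eqmodP/forallP h s|h].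
  by move: (h s); rewrite !basis_sact // !basis_eq0 => /eqP/negb_inj.
by apply/eqmodP/forallP=> s; rewrite !basis_sact // !basis_eq0 h.
Qed.

(** An idempotent [f] in the L-class of [y] satisfies [y * f = y], so it does
    not annihilate the class of [y]. *)
Lemma MJ_class_eq0 (S : finSemigroupType) (J : jclass S) y :
  regular J -> (MJ_class J y == 0%R) = (y \notin J).
Proof.
move=> regJ; apply/eqP/idP => [y0|yJ]; last first.
  by rewrite /MJ_class; move: yJ; rewrite -basis_eq0 => /eqP->.
apply/negP=> yJ; have [f [fJ ff /greenLP[_ [u yf]]]] := regular_Lidem regJ yJ.
move/eqmodP/forallP: y0 => /(_ f).
by rewrite basis_sact // sact0 eqxx basis_eq0 yf -lmul1M ff -yf yJ.
Qed.

(** A strictly irreducible element that is a sum of basis classes is one of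
    them; the induction is on the number of summands. *)
Lemma minM_sub_class (S : finSemigroupType) (J : jclass S) :
  minM (MJ J) \subset [set MJ_class J y | y in (J : {set S})].
Proof.
suff gen n (A : free_mod J) : (#|A| <= n)%N -> \pi_(MJ J) A \in minM (MJ J) ->
    \pi_(MJ J) A \in [set MJ_class J y | y in (J : {set S})].
  by apply/subsetP=> m; rewrite -[m]reprK; apply: gen.
elim: n A => [|n IHn] A leAn mA.
  move: mA; rewrite inE; case/andP=> /negP[]; move: leAn.
  by rewrite leqn0 cards_eq0 => /eqP->.
have [A0|[b bA]] := set_0Vmem A.
  by apply: IHn mA; rewrite A0 cards0.
have eA : \pi_(MJ J) A = (\pi_(MJ J) [set b] + \pi_(MJ J) (A :\ b))%R :> MJ J.
  by rewrite [RHS]MJ_piD; congr \pi; rewrite [RHS]setD1K.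
move: (mA); rewrite inE => /andP[_ /forallP/(_ (\pi_(MJ J) [set b]))].
move=> /forallP/(_ (\pi_(MJ J) (A :\ b))); rewrite -eA eqxx /= => /orP[] /eqP e.
  have [y yJ eb] : exists2 y, y \in J & val b = Lclass y.
    by apply/imsetP/(valP b).
  rewrite e; apply/imsetP; exists y => //.
  rewrite /MJ_class (@basis_set1 _ _ b) //.
  by rewrite eb Lclass_id.
rewrite e; apply: IHn; last by rewrite -e.
by rewrite -ltnS (leq_trans _ leAn) // [in X in (_ < X)%N](cardsD1 b) bA.
Qed.

(** * The character of the Schutzenberger representation *)

Local Open Scope ring_scope.

(** The trace is additive along the invariant line spanned by the [k]-th basis
    vector, on which [A] acts as the identity.  With [C] the projection to the
    quotient and [R] a section, [1 - C R] factors as [X U] through that line,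
    and [X U] has trace 1. *)
Lemma mxtrace_factmod_delta (F : fieldType) n (k : 'I_n) (A : 'M[F]_n) :
  row k A = delta_mx 0 k ->
  \tr (in_factmod (delta_mx k k : 'M_n) (val_factmod 1%:M *m A)) = \tr A - 1.
Proof.
move=> rowA; set U := delta_mx k k.
have UA : U *m A = U.
  by rewrite /U -(mul_delta_mx (0 : 'I_1)) -mulmxA -rowE rowA mul_delta_mx.
pose C := in_factmod U (1%:M : 'M_n); pose R := val_factmod (U := U) 1%:M.
have UC : U *m C = 0 by apply/eqP; rewrite -in_factmodE in_factmod_eq0.
rewrite in_factmodE -/R -/C -mulmxA mxtrace_mulC -mulmxA.
have /submxP[X eX] : (1%:M - C *m R <= U)%MS.
  rewrite -in_factmod_eq0 linearB /= subr_eq0.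
  by rewrite -/C -val_factmodE val_factmodK.
have -> : C *m R = 1%:M - X *m U by rewrite -eX opprB addrC subrK.
rewrite mulmxBr mulmx1 raddfB /=; congr (_ - _).
rewrite mulmxA mxtrace_mulC mulmxA UA mxtrace_mulC -eX.
have UXU : U *m X *m U = U.
  by rewrite -mulmxA -eX mulmxBr mulmxA UC mul0mx subr0 mulmx1.
have UU : U *m U = U by rewrite /U mul_delta_mx.
rewrite eX -UU mulmxA mxtrace_mulC mulmxA UXU /mxtrace (bigD1 k) //= !mxE !eqxx.
by rewrite big1 ?addr0 // => i /negPf ki; rewrite !mxE ki.
Qed.

(** Passing to the quotient by the line of the sink removes the sink from the
    fixed points of a 0/1 matrix with one nonzero entry per row. *)
Lemma sch_char_card (F : fieldType) (T : finSemigroupType) (R : {set T})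
    (t : T) :
  sch_char F R t = #|[set r in R | (r * t)%g == r]|%:R.
Proof.
rewrite /sch_char /sch_mx mxtrace_factmod_delta; last first.
  by apply/rowP=> j; rewrite !mxE enum_rankK eqxx /=
    -(inj_eq enum_val_inj) enum_rankK eq_sym.
rewrite /mxtrace.
rewrite (eq_bigr (fun i => (sch_act (enum_val i) t == enum_val i)%:R));
  last first.
  by move=> i _; rewrite mxE.
rewrite (reindex enum_rank) /=; last exact/onW_bij/enum_rank_bij.
under eq_bigr => o _ do rewrite enum_rankK.
rewrite (bigD1 None) //= addrAC subrr add0r -natr_sum.
apply: (congr1 (fun k => k%:R)).
rewrite -[in RHS](card_in_imset (f := fun r => insub r : sink_ext R)); last first.
  move=> r r'; rewrite !inE => /andP[rR _] /andP[r'R _].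
  by rewrite !insubT => -[].
rewrite -sum1_card big_mkcond [RHS]big_mkcond /=; apply: eq_bigr => -[r|] _ /=;
  last first.
  case: ifP => // /imsetP[r]; rewrite inE => /andP[rR _].
  by rewrite insubT.
congr nat_of_bool.
apply/eqP/imsetP => [|[r']].
  case: insubP => //= r' _ e [er]; exists (val r); last by rewrite valK.
  by rewrite inE (valP r) -e er eqxx.
rewrite inE => /andP[r'R /eqP e]; rewrite insubT => -[->] /=.
by rewrite e insubT.
Qed.

(** * Comparison of the fixed points *)

Lemma card_imset_eq (A B C : finType) (f : A -> B) (g : A -> C) (Y : {set A}) :
  {in Y &, forall y y', f y = f y' <-> g y = g y'} -> #|f @: Y| = #|g @: Y|.
Proof.
have leq (B' C' : finType) (f' : A -> B') (g' : A -> C') :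
    {in Y &, forall y y', f' y = f' y' -> g' y = g' y'} ->
    (#|g' @: Y| <= #|f' @: Y|)%N.
  move=> fg; have [->|[y0 y0Y]] := set_0Vmem Y.
    by rewrite !imset0 !cards0.
  pose h b := g' (odflt y0 [pick y in Y | f' y == b]).
  suff <- : h @: (f' @: Y) = g' @: Y by apply: leq_imset_card.
  rewrite -imset_comp; apply: eq_in_imset => y yY; rewrite /h /=.
  by case: pickP => [y' /andP[y'Y /eqP e]|/(_ y)]; [apply: fg | rewrite yY eqxx].
move=> fg; apply/eqP; rewrite eqn_leq !leq // => y y' yY y'Y e.
  by apply/(fg y y').
by apply/(fg y y').
Qed.

Lemma quo_eq_MJ_class (S : finSemigroupType) (J : jclass S) (E : congruence S)
    y y' :
    regular J -> AGGM_congruence J E -> y \in J -> y' \in J ->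
    greenR (quo_map E y) (quo_map E y') ->
  quo_map E y = quo_map E y' <-> MJ_class J y = MJ_class J y'.
Proof.
move=> regJ hE yJ y'J Ryy'; split=> [e|/(MJ_class_eqP yJ y'J) annE]; last first.
  exact: quo_eq_of_annihilator regJ hE yJ y'J Ryy' annE.
apply/MJ_class_eqP=> // s.
by rewrite -(mem_quo_mulr _ hE yJ) -(mem_quo_mulr _ hE y'J) !quo_mapM e.
Qed.

Theorem theorem4p15 (K : realType) (S : finSemigroupType) (J : jclass S)
    (regJ : regular J) (E : congruence S) (hE : AGGM_congruence J E) :
  exists D : {set MJ J},
    [/\ minM (MJ J) \subset D,
        D \subset [set~ 0] &
        forall x : quo E, x \in [set quo_map E s | s in (J : {set S})] ->
        forall s : S,
          (gen_char D s)%:R = sch_char K[i] (Rclass x) (quo_map E s) :> K[i]].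
Proof.
exists [set MJ_class J y | y in (J : {set S})]; split.
- exact: minM_sub_class.
- apply/subsetP=> _ /imsetP[y yJ ->].
  by rewrite !inE MJ_class_eq0 // negbK.
move=> _ /imsetP[x0 x0J ->] s; rewrite sch_char_card.
apply: (congr1 (fun k => k%:R)); rewrite /gen_char.
pose Y := [set y in (J : {set S}) | greenR (quo_map E x0) (quo_map E y)
                                    && (quo_map E (y * s)%g == quo_map E y)].
have YP y : y \in Y -> [/\ y \in J, greenR (quo_map E x0) (quo_map E y)
                         & quo_map E (y * s)%g = quo_map E y].
  by rewrite inE => /and3P[yJ Ry /eqP].
(* A product whose image in the quotient is that of [y] cannot leave [J]. *)
have YsJ y : y \in Y -> (y * s)%g \in J.
  by case/YP=> yJ _ e; rewrite -(mem_quo_mulr _ hE yJ) e imset_f.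
have -> : [set m in [set MJ_class J y | y in (J : {set S})] | sact m s == m]
          = MJ_class J @: Y.
  apply/setP=> m; rewrite inE; apply/andP/imsetP=> [[]|[y yY ->]].
    case/imsetP=> y0 y0J -> /eqP.
    have [y [yJ Ryx Lyy0]] := jclass_DP x0J y0J.
    have -> : MJ_class J y0 = MJ_class J y.
      apply/MJ_class_eqP=> // t; have := greenLM t Lyy0 => Lt.
      by apply/idP/idP => /jclass_Lclass; apply; rewrite inE // greenL_sym.
    rewrite MJ_class_sact // => e; exists y => //.
    have ysJ : (y * s)%g \in J.
      by rewrite -[_ \in _]negbK -MJ_class_eq0 // e MJ_class_eq0 // yJ.
    rewrite inE yJ (greenR_quo E (greenR_sym Ryx)) /=; apply/eqP.
    by apply/(quo_eq_MJ_class regJ hE) => //; apply/greenR_quo/(jclass_stableR yJ).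
  have [yJ _ e] := YP y yY; rewrite imset_f // MJ_class_sact //; split=> //.
  apply/eqP/(quo_eq_MJ_class regJ hE) => //; first exact: YsJ.
  exact/greenR_quo/(jclass_stableR yJ)/YsJ.
have -> : [set r in Rclass (quo_map E x0) | (r * quo_map E s)%g == r]
          = quo_map E @: Y.
  apply/setP=> r; rewrite !inE; apply/andP/imsetP=> [[Rr /eqP e]|[y yY ->]].
    have [[I [[dI _ _] _]] _] := hE.
    have /imsetP[y yJ ry] := distinguished_greenR dI (imset_f _ x0J) (greenR_sym Rr).
    by exists y; rewrite // inE yJ -ry Rr quo_mapM -ry e eqxx.
  by have [yJ Ry e] := YP y yY; rewrite -quo_mapM e.
apply: card_imset_eq => y y' /YP[yJ Ry _] /YP[y'J Ry' _].
apply: iff_sym; apply: quo_eq_MJ_class => //.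
exact: greenR_trans (greenR_sym Ry) Ry'.
Qed.
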